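(* Let $A=A_n(\mathbb{C})/I$, where $I$ is a homogeneous two-sided ideal of the free algebra $A_n(\mathbb{C})=\mathbb{C}\langle x_1,\dots,x_n\rangle$ (graded by $\deg x_i=1$). Let $q\ge 3$, and suppose that $B_2(A)[m]=0$ for all $m\ge q$, and that for some $m\ge q+1$ the natural map $\psi: FL_n^{\ge 2}\to [A,A]$ is surjective in degrees $m$ and $m-1$. Then for all $\ell\ge m-1$ one has $$[A,A][\ell]=L_\ell(A)[\ell]=B_\ell(A)[\ell]$$ and $B_s(A)[\ell]=0$ for $2\le s\le \ell-1$.
   Context: For an associative unital algebra $A$ with commutator $[a,b]=ab-ba$, set $L_1(A)=A$ and $L_{i+1}(A)=[A,L_i(A)]$ for $i\ge 1$, where $[C,D]$ denotes the linear span of all $[c,d]$ with $c\in C$, $d\in D$. Put $B_i(A)=L_i(A)/L_{i+1}(A)$. If $A$ is graded, these spaces inherit gradings, and $Y[r]$ denotes the degree $r$ component of a graded space $Y$. For $A$ a graded quotient of $A_n(\mathbb{C})$, $L_{\ell+1}(A)$ lives in degrees $\ge \ell+1$, so $B_\ell(A)[\ell]$ is identified with $L_\ell(A)[\ell]$. $FL_n$ is the free Lie algebra over $\mathbb{C}$ in $n$ generators $x_1,\dots,x_n$, graded by $\deg x_i=1$, and $FL_n^{\ge 2}$ is its part of degree $\ge 2$. There is a natural graded Lie algebra homomorphism $FL_n\to A$ sending each generator $x_i$ to the image of $x_i$ in $A$; it maps $FL_n^{\ge 2}$ into $[A,A]$, and $\psi: FL_n^{\ge 2}\to[A,A]$ is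 the resulting restriction. ''Surjective in degree $m$'' means that $\psi: FL_n[m]\to [A,A][m]$ is surjective. *)

(* Defs.v *)
From HB Require Import structures.
From mathcomp Require Import all_boot all_order all_algebra.
From mathcomp Require Import finmap boolp classical_sets functions reals.
From mathcomp Require Import complex monalg.

Set Implicit Arguments.
Unset Strict Implicit.
Unset Printing Implicit Defensive.

Import GRing.Theory.
Local Open Scope classical_set_scope.
Local Open Scope quotient_scope.
Local Open Scope ring_scope.

Section Span.
Variables (K : pzRingType) (V : lmodType K).

Definition lspan (S : set V) : {pred V} := fun v =>
  `[< exists k (c : 'I_k -> K) (s : 'I_k -> V),
        (forall i, S (s i)) /\ v = \sum_(i < k) c i *: s i >].

Lemma lspan_submod (S : set V) : submod_closed (lspan S).
Proof.
split; first by apply/asboolP; exists 0%N, (fun=> 0), (fun=> 0); split;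
  [case | rewrite big_ord0].
move=> a u v /asboolP[k [c [s [Ss ->]]]] /asboolP[l [d [t [St ->]]]].
apply/asboolP; exists (k + l)%N.
exists (fun i =>
  match fintype.split i with inl j => a * c j | inr j => d j end).
exists (fun i => match fintype.split i with inl j => s j | inr j => t j end).
split=> [i|]; first by case: (fintype.split i).
rewrite big_split_ord /= scaler_sumr; congr (_ + _); apply: eq_bigr => i _.
  by rewrite (unsplitK (inl i)) scalerA.
by rewrite (unsplitK (inr i)).
Qed.

HB.instance Definition _ (S : set V) :=
  GRing.isSubmodClosed.Build K V (lspan S) (lspan_submod S).

End Span.

(* The quotient module V / W: the additive quotient from the library (which
   only uses additive closure, despite its name) with the induced scaling. *)
Section LmodQuotient.
Variables (K : pzRingType) (V : lmodType K) (W : submodClosed V).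

Definition zmodpred : {pred V} := fun v => v \in W.

Fact zmodpred_closed : zmod_closed zmodpred.
Proof.
split=> [|x y xW yW]; first exact: rpred0.
by rewrite -scaleN1r; apply: rpredD => //; apply: rpredZ.
Qed.

HB.instance Definition _ := GRing.isZmodClosed.Build V zmodpred zmodpred_closed.

Definition lquot : Type := {ideal_quot zmodpred}.

HB.instance Definition _ := GRing.Zmodule.on lquot.

(* Projection and representatives are locked to keep conversion tests cheap. *)
Fact lpi_key : unit. Proof. by []. Qed.
Definition lpi : V -> lquot :=
  locked_with lpi_key (fun v => \pi_{ideal_quot zmodpred} v).

Fact lrepr_key : unit. Proof. by []. Qed.
Definition lrepr : lquot -> V :=
  locked_with lrepr_key (fun x : {ideal_quot zmodpred} => repr x).

Lemma lpiE v : lpi v = \pi_{ideal_quot zmodpred} v.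
Proof. by rewrite /lpi unlock. Qed.

Lemma lreprK (x : lquot) : lpi (lrepr x) = x.
Proof.
rewrite lpiE /lrepr [locked_with _ _]unlock.
exact: (@reprK _ {ideal_quot zmodpred} x).
Qed.

Lemma lpi_eq (x y : V) : lpi x = lpi y <-> x - y \in W.
Proof.
rewrite -[_ \in W]/(_ \in zmodpred) (@Quotient.idealrBE V zmodpred) !lpiE.
by split=> [h|/eqP //]; apply/eqP.
Qed.

Lemma lpi_is_zmod : zmod_morphism lpi.
Proof.
by move=> x y; rewrite !lpiE; apply: (raddfB \pi_{ideal_quot zmodpred}).
Qed.

HB.instance Definition _ := GRing.isZmodMorphism.Build V lquot lpi lpi_is_zmod.

Lemma lrepr_pi (x : V) : x - lrepr (lpi x) \in W.
Proof. by apply/lpi_eq; rewrite lreprK. Qed.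

Definition lquot_scale (k : K) (x : lquot) : lquot := lpi (k *: lrepr x).

Lemma lpiZ (k : K) (x : V) : lpi (k *: x) = lquot_scale k (lpi x).
Proof. by apply/lpi_eq; rewrite -scalerBr rpredZ // lrepr_pi. Qed.

Fact lquot_scaleA a b x :
  lquot_scale a (lquot_scale b x) = lquot_scale (a * b) x.
Proof. by rewrite -[x]lreprK -!lpiZ scalerA. Qed.

Fact lquot_scale1 : left_id 1 lquot_scale.
Proof. by move=> x; rewrite -[x]lreprK -!lpiZ scale1r. Qed.

Fact lquot_scaleDr : right_distributive lquot_scale +%R.
Proof.
by move=> a x y; rewrite -[x]lreprK -[y]lreprK -raddfD -!lpiZ scalerDr raddfD.
Qed.

Fact lquot_scaleDl x : {morph lquot_scale^~ x : a b / a + b}.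
Proof. by move=> a b; rewrite -[x]lreprK -!lpiZ scalerDl raddfD. Qed.

HB.instance Definition _ := GRing.Zmodule_isLmodule.Build K lquot
  lquot_scaleA lquot_scale1 lquot_scaleDr lquot_scaleDl.

Fact lpi_is_scalable : scalable lpi.
Proof. exact: lpiZ. Qed.

HB.instance Definition _ :=
  GRing.isScalable.Build K V lquot *:%R lpi lpi_is_scalable.

End LmodQuotient.

HB.mixin Record isTwoSidedIdeal (A : pzRingType) (S : A -> bool) := {
  tsidealMl : forall a x : A, x \in S -> a * x \in S;
  tsidealMr : forall a x : A, x \in S -> x * a \in S
}.

(* Linearity is no restriction: an additive ideal of a unital algebra is
   automatically a linear subspace. *)
#[short(type="tsIdeal")]
HB.structure Definition TwoSidedIdeal (K : pzRingType) (A : algType K) :=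
  {S of GRing.AddClosed A S & GRing.isScaleClosed K A S & isTwoSidedIdeal A S}.

HB.mixin Record isLieAlgebra (K : pzRingType) V of GRing.Lmodule K V := {
  lie : V -> V -> V;
  lie_linearl : forall y : V, linear (lie^~ y);
  lie_linearr : forall x : V, linear (lie x);
  liexx : forall x : V, lie x x = 0;
  lie_jacobi : forall x y z : V,
    lie x (lie y z) + lie y (lie z x) + lie z (lie x y) = 0
}.

#[short(type="lieAlgType")]
HB.structure Definition LieAlgebra (K : pzRingType) :=
  {V of GRing.Lmodule K V & isLieAlgebra K V}.

Lemma lie0r (K : pzRingType) (V : lieAlgType K) (x : V) : lie x 0 = 0.
Proof.
by rewrite -[0 in LHS](addNr 0) -scaleN1r lie_linearr scaleN1r addNr.
Qed.

Lemma lie0l (K : pzRingType) (V : lieAlgType K) (x : V) : lie 0 x = 0.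
Proof.
by rewrite -[0 in LHS](addNr 0) -scaleN1r lie_linearl scaleN1r addNr.
Qed.

(* The quotient of an algebra by a two-sided ideal. It need not be an algType,
   which requires 1 != 0: the ideal may be the whole algebra. *)
Section AlgQuotient.
Variables (K : pzRingType) (F : algType K) (I : tsIdeal F).

Definition algquot : Type := lquot I.

HB.instance Definition _ := GRing.Lmodule.on algquot.

Definition apr : F -> algquot := @lpi K F I.

HB.instance Definition _ := GRing.Linear.on apr.

Local Notation rep x := (@lrepr K F I x).

Definition algquot_mul (x y : algquot) : algquot := apr (rep x * rep y).

Lemma aprM_def x y : apr (x * y) = algquot_mul (apr x) (apr y).
Proof.
apply/(@lpi_eq K F I).
rewrite (_ : _ - _ = (x - rep (apr x)) * y + rep (apr x) * (y - rep (apr y))).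
  by rewrite rpredD //; [apply: tsidealMr | apply: tsidealMl]; apply: lrepr_pi.
by rewrite mulrBl mulrBr addrA subrK.
Qed.

Lemma apr_ind (P : algquot -> Prop) : (forall x, P (apr x)) -> forall x, P x.
Proof. by move=> Ppi x; rewrite -[x](@lreprK K F I); apply: Ppi. Qed.

Fact algquot_mulA : associative algquot_mul.
Proof.
elim/apr_ind=> x; elim/apr_ind=> y; elim/apr_ind=> z.
by rewrite -!aprM_def mulrA.
Qed.

Fact algquot_mul1x : left_id (apr 1) algquot_mul.
Proof. by elim/apr_ind=> x; rewrite -aprM_def mul1r. Qed.

Fact algquot_mulx1 : right_id (apr 1) algquot_mul.
Proof. by elim/apr_ind=> x; rewrite -aprM_def mulr1. Qed.

Fact algquot_mulDl : left_distributive algquot_mul +%R.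
Proof.
elim/apr_ind=> x; elim/apr_ind=> y; elim/apr_ind=> z.
by rewrite -raddfD -!aprM_def mulrDl raddfD.
Qed.

Fact algquot_mulDr : right_distributive algquot_mul +%R.
Proof.
elim/apr_ind=> x; elim/apr_ind=> y; elim/apr_ind=> z.
by rewrite -raddfD -!aprM_def mulrDr raddfD.
Qed.

HB.instance Definition _ := GRing.Zmodule_isPzRing.Build algquot
  algquot_mulA algquot_mul1x algquot_mulx1 algquot_mulDl algquot_mulDr.

Lemma apr_is_monoid_morphism : monoid_morphism apr.
Proof. by split=> // x y; rewrite aprM_def. Qed.

HB.instance Definition _ :=
  GRing.isMonoidMorphism.Build F algquot apr apr_is_monoid_morphism.

Lemma aprM x y : apr (x * y) = apr x * apr y.
Proof. exact: rmorphM. Qed.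

Lemma aprZ k x : apr (k *: x) = k *: apr x.
Proof. exact: linearZ. Qed.

Lemma algquot_scalerAl k (x y : algquot) : k *: (x * y) = (k *: x) * y.
Proof.
elim/apr_ind: x => x; elim/apr_ind: y => y.
by rewrite -aprZ -!aprM -aprZ -scalerAl.
Qed.

Lemma algquot_scalerAr k (x y : algquot) : k *: (x * y) = x * (k *: y).
Proof.
elim/apr_ind: x => x; elim/apr_ind: y => y.
by rewrite -aprZ -!aprM -aprZ -scalerAr.
Qed.

Definition comm (x y : algquot) : algquot := x * y - y * x.

Lemma apr_comm x y : apr (x * y - y * x) = comm (apr x) (apr y).
Proof. by rewrite raddfB /= !aprM. Qed.

Fact comm_linearl y : linear (comm^~ y).
Proof.
move=> a u v; rewrite /comm mulrDl mulrDr -algquot_scalerAl -algquot_scalerAr.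
by rewrite opprD addrACA scalerBr.
Qed.

Fact comm_linearr x : linear (comm x).
Proof.
move=> a u v; rewrite /comm mulrDl mulrDr -algquot_scalerAl -algquot_scalerAr.
by rewrite opprD addrACA scalerBr.
Qed.

Fact commxx x : comm x x = 0.
Proof. exact: subrr. Qed.

Fact comm_jacobi x y z :
  comm x (comm y z) + comm y (comm z x) + comm z (comm x y) = 0.
Proof.
rewrite /comm !mulrBl !mulrBr !mulrA !opprB.
set a := x * y * z; set b := x * z * y; set c := y * z * x.
set d := y * x * z; set e := z * x * y; set f := z * y * x.
rewrite [a - b](addrC a) [c - d](addrC c) [e - f](addrC e) !addrA.
rewrite [LHS](ACl ((2*12)*(7*1)*(3*9)*(6*4)*(11*5)*(10*8)))/=.
by rewrite !subrr !addr0.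
Qed.

HB.instance Definition _ := isLieAlgebra.Build K algquot
  comm_linearl comm_linearr commxx comm_jacobi.

(* [C, D], the linear span of the commutators. *)
Definition commspan (C D : {pred algquot}) : {pred algquot} :=
  lspan [set u | exists c d, [/\ c \in C, d \in D & u = comm c d]].

(* L_i(A), for i >= 1; the value at i = 0 is not used. *)
Definition lcs (i : nat) : {pred algquot} :=
  iter i.-1 (commspan predT) predT.

Fact lcs_submod i : submod_closed (lcs i).
Proof. by rewrite /lcs; case: i.-1 => [|j]; [|exact: lspan_submod]. Qed.

HB.instance Definition _ i :=
  GRing.isSubmodClosed.Build K algquot (lcs i) (lcs_submod i).

End AlgQuotient.

Arguments apr {K F} I _.
Arguments commspan {K F I} C D.
Arguments lcs {K F} I i.

Definition homog (K : nzRingType) (M : choiceType) (deg : M -> nat) (r : nat) :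
  set {malg K[M]} := [set f | forall k, k \in msupp f -> deg k = r].

(* hcomp r f is the degree r component of f, where deg grades the basis M. *)
Definition hcomp (K : nzRingType) (M : choiceType) (deg : M -> nat) (r : nat)
    (f : {malg K[M]}) : {malg K[M]} :=
  \sum_(k <- msupp f | deg k == r) << f@_k *g k >>.

Section FreeAlgebra.
Variables (K : fieldType) (n : nat).

(* The monoid algebra of the free monoid on n letters. *)
Definition free_alg : Type := {malg K[{fmonom 'I_n}]}.

HB.instance Definition _ := GRing.Lalgebra.on free_alg.

Fact free_alg_scalerAr (k : K) (x y : free_alg) : k *: (x * y) = x * (k *: y).
Proof.
apply: (proj1 (@malgP _ K _ _)) => m.
rewrite mcoeffZ [in LHS]mcoeffMl.
rewrite [RHS](mcoeffMlw _ (fsubset_refl _) (msuppZ_le k y)) mulr_sumr.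
apply: eq_bigr => i _; rewrite mulr_sumr; apply: eq_bigr => j _.
by rewrite mcoeffZ mulrCA mulrnAr.
Qed.

HB.instance Definition _ :=
  GRing.Lalgebra_isAlgebra.Build K free_alg free_alg_scalerAr.

Definition free_gen (i : 'I_n) : free_alg := << fmu i >>.

Definition homogeneous_ideal (I : tsIdeal free_alg) : Prop :=
  forall (f : free_alg) r, f \in I -> hcomp (@fdeg 'I_n) r f \in I.

End FreeAlgebra.

(* Free Lie algebra: nonassociative words form a basis of the free
   nonassociative algebra, which is then divided by the ideal generated by the
   Lie algebra identities. *)
Inductive lie_word (n : nat) : Type :=
  | LVar of 'I_n
  | LBr of lie_word n & lie_word n.

Section LieWord.
Variable n : nat.

Fixpoint lie_word_encode (t : lie_word n) : GenTree.tree 'I_n :=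
  match t with
  | LVar i => GenTree.Leaf i
  | LBr s t => GenTree.Node 0 [:: lie_word_encode s; lie_word_encode t]
  end.

Fixpoint lie_word_decode (t : GenTree.tree 'I_n) : option (lie_word n) :=
  match t with
  | GenTree.Leaf i => Some (LVar i)
  | GenTree.Node _ [:: s; t] =>
      if (lie_word_decode s, lie_word_decode t) is (Some s', Some t')
      then Some (LBr s' t') else None
  | _ => None
  end.

Lemma lie_word_encodeK : pcancel lie_word_encode lie_word_decode.
Proof. by elim=> //= s -> t ->. Qed.

HB.instance Definition _ :=
  Choice.copy (lie_word n) (pcan_type lie_word_encodeK).

Fixpoint lie_deg (t : lie_word n) : nat :=
  match t with LVar _ => 1 | LBr s t => lie_deg s + lie_deg t end.

End LieWord.

Section Linext.
Variables (K : fieldType) (M : choiceType) (V : lmodType K) (h : M -> V).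

Definition linext (f : {malg K[M]}) : V := \sum_(k <- msupp f) f@_k *: h k.

Lemma linextEw (D : {fset M}) (f : {malg K[M]}) :
  fsubset (msupp f) D -> linext f = \sum_(k <- D) f@_k *: h k.
Proof.
move=> le; rewrite /linext (big_fset_incl _ le) //= => k _ /mcoeff_outdom ->.
by rewrite scale0r.
Qed.

Fact linext_is_linear : linear linext.
Proof.
move=> a f g.
set D := (msupp f `|` msupp g)%fset.
have fD : fsubset (msupp f) D by apply: fsubsetUl.
have gD : fsubset (msupp g) D by apply: fsubsetUr.
rewrite (@linextEw D (a *: f + g)); last first.
  apply: fsubset_trans (msuppD_le _ _) _; rewrite fsubUset gD andbT.
  exact: fsubset_trans (msuppZ_le _ _) fD.
rewrite (linextEw fD) (linextEw gD) scaler_sumr -big_split /=.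
by apply: eq_bigr => k _; rewrite mcoeffD mcoeffZ scalerDl scalerA.
Qed.

HB.instance Definition _ :=
  GRing.isLinear.Build K {malg K[M]} V *:%R linext linext_is_linear.

Lemma linextD f g : linext (f + g) = linext f + linext g.
Proof. exact: raddfD. Qed.

Lemma linextU c k : linext << c *g k >> = c *: h k.
Proof. by rewrite (linextEw msuppU_le) big_seq_fset1 mcoeffUU. Qed.

End Linext.

Lemma linext_lin (K : fieldType) (M : choiceType) (V W : lmodType K)
    (phi : V -> W) (h : M -> V) (f : {malg K[M]}) :
  linear phi -> phi (linext h f) = linext (phi \o h) f.
Proof.
move=> lin_phi; rewrite /linext; elim/big_rec2: _ => [|k u v _ IH].
  by rewrite -[0](addNr 0) -scaleN1r lin_phi scaleN1r addNr.
by rewrite lin_phi IH.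
Qed.

Lemma eq_linext (K : fieldType) (M : choiceType) (V : lmodType K)
    (h1 h2 : M -> V) : h1 =1 h2 -> linext h1 =1 linext h2.
Proof. by move=> eqh f; apply: eq_bigr => k _; rewrite eqh. Qed.

Lemma malgUZ (K : nzRingType) (M : choiceType) (a b : K) (k : M) :
  << a * b *g k >> = a *: (b *: << k >>) :> {malg K[M]}.
Proof. by apply/malgP=> l; rewrite !mcoeffZ !mcoeffU !mulrnAr mulr1. Qed.

Section FreeLie.
Variables (K : fieldType) (n : nat).

Definition free_nalg : Type := {malg K[lie_word n]}.

HB.instance Definition _ := GRing.Lmodule.on free_nalg.

Fact nmul_key : unit. Proof. by []. Qed.

(* The bilinear extension of LBr, locked to keep conversion tests cheap. *)
Definition nmul : free_nalg -> free_nalg -> free_nalg :=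
  locked_with nmul_key (fun f g =>
    \sum_(s <- msupp f) \sum_(t <- msupp g) << f@_s * g@_t *g LBr s t >>).

Lemma nmulE f g :
  nmul f g = linext (fun s => linext (fun t => << LBr s t >>) g) f.
Proof.
rewrite /nmul unlock /linext; apply: eq_bigr => s _; rewrite scaler_sumr.
by apply: eq_bigr => t _; apply: malgUZ.
Qed.

Fact nmul_linearl g : linear (nmul^~ g).
Proof. by move=> a u v; rewrite !nmulE linext_is_linear. Qed.

Fact nmul_linearr f : linear (nmul f).
Proof.
move=> a g h; rewrite !nmulE /linext scaler_sumr -big_split /=.
apply: eq_bigr => s _; rewrite -!/(linext _ _) linearP scalerDr !scalerA.
by rewrite mulrC.
Qed.

Inductive lie_ideal_gen : free_nalg -> Prop :=
  | LieGenAlt x : lie_ideal_gen (nmul x x)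
  | LieGenJacobi x y z : lie_ideal_gen
      (nmul x (nmul y z) + nmul y (nmul z x) + nmul z (nmul x y))
  | LieGen0 : lie_ideal_gen 0
  | LieGenP a x y : lie_ideal_gen x -> lie_ideal_gen y ->
      lie_ideal_gen (a *: x + y)
  | LieGenMl x y : lie_ideal_gen y -> lie_ideal_gen (nmul x y)
  | LieGenMr x y : lie_ideal_gen x -> lie_ideal_gen (nmul x y).

Definition lie_ideal : {pred free_nalg} := fun x => `[< lie_ideal_gen x >].

Fact lie_ideal_submod : submod_closed lie_ideal.
Proof.
split; first by apply/asboolP; exact: LieGen0.
by move=> a x y /asboolP xI /asboolP yI; apply/asboolP; apply: LieGenP.
Qed.

HB.instance Definition _ :=
  GRing.isSubmodClosed.Build K free_nalg lie_ideal lie_ideal_submod.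

Definition free_lie : Type := lquot lie_ideal.

HB.instance Definition _ := GRing.Lmodule.on free_lie.

Definition flpr : free_nalg -> free_lie := @lpi K free_nalg lie_ideal.

HB.instance Definition _ := GRing.Linear.on flpr.

Definition flrepr : free_lie -> free_nalg := @lrepr K free_nalg lie_ideal.

Lemma flreprK x : flpr (flrepr x) = x.
Proof. exact: lreprK. Qed.

Lemma flprD x y : flpr (x + y) = flpr x + flpr y.
Proof. exact: raddfD. Qed.

Lemma flprP a x y : flpr (a *: x + y) = a *: flpr x + flpr y.
Proof. exact: linearP. Qed.

Lemma flpr_eq x y : flpr x = flpr y <-> lie_ideal_gen (x - y).
Proof.
split=> [/(@lpi_eq K free_nalg lie_ideal) /asboolP //|h].
by apply/(@lpi_eq K free_nalg lie_ideal)/asboolP.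
Qed.

Lemma flpr_ind (P : free_lie -> Prop) :
  (forall x, P (flpr x)) -> forall x, P x.
Proof. by move=> Ppi x; rewrite -[x]flreprK; apply: Ppi. Qed.

Definition fl_lie (x y : free_lie) : free_lie :=
  flpr (nmul (flrepr x) (flrepr y)).

Lemma flprM x y : flpr (nmul x y) = fl_lie (flpr x) (flpr y).
Proof.
have nmulBr f g h : nmul f (g - h) = nmul f g - nmul f h.
  by rewrite addrC -scaleN1r nmul_linearr scaleN1r addrC.
have nmulBl f g h : nmul (g - h) f = nmul g f - nmul h f.
  by rewrite addrC -scaleN1r nmul_linearl scaleN1r addrC.
have E u : lie_ideal_gen (u - flrepr (flpr u)).
  by apply/flpr_eq; rewrite flreprK.
apply/flpr_eq; set x' := flrepr _; set y' := flrepr _.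
rewrite (_ : _ - _ = 1 *: nmul (x - x') y + nmul x' (y - y')).
  by apply: LieGenP; [apply: LieGenMr | apply: LieGenMl]; apply: E.
by rewrite scale1r nmulBl nmulBr addrA subrK.
Qed.

Fact fl_linearl y : linear (fl_lie^~ y).
Proof.
move: y; elim/flpr_ind=> y a; elim/flpr_ind=> u; elim/flpr_ind=> v.
rewrite -[X in fl_lie X _ = _]flprP -!flprM.
exact: etrans (congr1 flpr (nmul_linearl _ a u v)) (flprP _ _ _).
Qed.

Fact fl_linearr x : linear (fl_lie x).
Proof.
move: x; elim/flpr_ind=> x a; elim/flpr_ind=> u; elim/flpr_ind=> v.
rewrite -[X in fl_lie _ X = _]flprP -!flprM.
exact: etrans (congr1 flpr (nmul_linearr _ a u v)) (flprP _ _ _).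
Qed.

Fact fl_liexx x : fl_lie x x = 0.
Proof.
elim/flpr_ind: x => x; rewrite -flprM -(raddf0 flpr).
by apply/flpr_eq; rewrite subr0; apply: LieGenAlt.
Qed.

Fact fl_jacobi x y z :
  fl_lie x (fl_lie y z) + fl_lie y (fl_lie z x) + fl_lie z (fl_lie x y) = 0.
Proof.
elim/flpr_ind: x => x; elim/flpr_ind: y => y; elim/flpr_ind: z => z.
rewrite -!flprM -!flprD -(raddf0 flpr).
by apply/flpr_eq; rewrite subr0; apply: LieGenJacobi.
Qed.

HB.instance Definition _ := isLieAlgebra.Build K free_lie
  fl_linearl fl_linearr fl_liexx fl_jacobi.

Definition fl_gen (i : 'I_n) : free_lie := flpr << LVar i >>.

(* FL_n[r] *)
Definition fl_comp (r : nat) : set free_lie := flpr @` homog (@lie_deg n) r.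

Section Lift.
Variables (V : lieAlgType K) (a : 'I_n -> V).

Fixpoint word_eval (t : lie_word n) : V :=
  match t with LVar i => a i | LBr s t => lie (word_eval s) (word_eval t) end.

(* The Lie algebra morphism sending the i-th generator to a i. *)
Definition fl_lift (x : free_lie) : V := linext word_eval (flrepr x).

Lemma linext_nmul (x y : free_nalg) : linext word_eval (nmul x y) =
  lie (linext word_eval x) (linext word_eval y).
Proof.
rewrite nmulE (linext_lin _ _ (@linext_is_linear _ _ _ word_eval)).
rewrite (linext_lin _ _ (@lie_linearl K V (linext word_eval y))).
apply: eq_linext => s /=; rewrite (linext_lin _ _ (@lie_linearr K V _)).
rewrite (linext_lin _ _ (@linext_is_linear _ _ _ word_eval)).
by apply: eq_linext => t /=; rewrite linextU scale1r.
Qed.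

Lemma fl_liftE x : fl_lift (flpr x) = linext word_eval x.
Proof.
suff h z : lie_ideal_gen z -> linext word_eval z = 0.
  have /flpr_eq/h : flpr x = flpr (flrepr (flpr x)) by rewrite flreprK.
  by rewrite raddfB => /eqP; rewrite subr_eq0 => /eqP.
elim=> {x z} [x|x y z||b x y _ xI _ yI|x y _ yI|x y _ xI].
- by rewrite linext_nmul liexx.
- by rewrite !linextD !linext_nmul lie_jacobi.
- exact: raddf0.
- by rewrite linext_is_linear xI yI scaler0 addr0.
- by rewrite linext_nmul yI lie0r.
- by rewrite linext_nmul xI lie0l.
Qed.

Lemma fl_lift_gen i : fl_lift (fl_gen i) = a i.
Proof. by rewrite fl_liftE linextU scale1r. Qed.

Fact fl_lift_is_linear : linear fl_lift.
Proof.
move=> c; elim/flpr_ind=> u; elim/flpr_ind=> v.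
by rewrite -linearP !fl_liftE linearP.
Qed.

Lemma fl_lift_lie x y : fl_lift (lie x y) = lie (fl_lift x) (fl_lift y).
Proof.
elim/flpr_ind: x => x; elim/flpr_ind: y => y.
by rewrite -[lie _ _]flprM !fl_liftE linext_nmul.
Qed.

End Lift.

End FreeLie.

Arguments fl_comp K {n} r.

Section GradedQuotient.
Variables (K : fieldType) (n : nat) (I : tsIdeal (free_alg K n)).

Local Notation A := (algquot I).

(* Y[r] for a graded subspace Y of A *)
Definition gr_comp (Y : {pred A}) (r : nat) : set A :=
  [set a | a \in Y] `&` (apr I @` homog (@fdeg 'I_n) r).

Definition comm_comp (r : nat) : set A := gr_comp (commspan predT predT) r.

Definition lcs_comp (i r : nat) : set A := gr_comp (lcs I i) r.

Definition lcs_pr (i : nat) : A -> lquot (lcs I i.+1) := @lpi _ _ _.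

(* B_i(A)[r], as a subspace of A / L_{i+1}(A) *)
Definition B_comp (i r : nat) : set (lquot (lcs I i.+1)) :=
  lcs_pr i @` lcs_comp i r.

Definition psi : free_lie K n -> A :=
  @fl_lift K n A (fun i => apr I (free_gen K i)).

Lemma homog_sum (T : eqType) (s : seq T) (c : T -> K) (g : T -> free_alg K n)
    r :
  (forall k, k \in s -> homog (@fdeg 'I_n) r (g k)) ->
  homog (@fdeg 'I_n) r (\sum_(k <- s) c k *: g k).
Proof.
move=> sg; rewrite big_seq; apply: (big_ind (homog (@fdeg 'I_n) r)).
- by move=> k; rewrite msupp0 inE.
- move=> f h fr hr k /(fsubsetP (msuppD_le _ _)); rewrite inE.
  by case/orP=> [/fr|/hr].
- move=> k /sg gr l /(fsubsetP (msuppZ_le _ _)); exact: gr.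
Qed.

Lemma homogM (f g : free_alg K n) r s : homog (@fdeg 'I_n) r f ->
  homog (@fdeg 'I_n) s g -> homog (@fdeg 'I_n) (r + s) (f * g).
Proof.
by move=> fr gs k /msuppM_le[k1 [k2 [/fr <- /gs <- ->]]]; rewrite fdegM.
Qed.

Fixpoint word_free (t : lie_word n) : free_alg K n :=
  match t with
  | LVar i => free_gen K i
  | LBr s t => word_free s * word_free t - word_free t * word_free s
  end.

Lemma word_free_homog t : homog (@fdeg 'I_n) (lie_deg t) (word_free t).
Proof.
elim: t => [i k|s IHs t IHt] /=.
  by rewrite msuppU1 inE => /eqP->; rewrite fdegU.
move=> k /(fsubsetP (msuppB_le _ _)); rewrite inE => /orP[].
  exact: homogM.
by rewrite addnC; apply: homogM.
Qed.

Lemma word_evalE t :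
  @word_eval K n A (fun i => apr I (free_gen K i)) t = apr I (word_free t).
Proof. by elim: t => //= s -> t ->; rewrite apr_comm. Qed.

Lemma psi_fun m : (1 < m)%N -> set_fun (fl_comp K m) (comm_comp m) psi.
Proof.
move=> m_gt1 _ [f fm <-]; rewrite /psi fl_liftE; split.
  rewrite /= /linext big_seq; apply: rpred_sum => t /fm; case: t => [i|s t _].
    by move=> m1; rewrite -m1 in m_gt1.
  apply: rpredZ; set u := word_eval _ _.
  apply/asboolP; exists 1%N, (fun=> 1), (fun=> u).
  split=> [_|]; last by rewrite big_ord1 scale1r.
  pose ev := @word_eval K n A (fun i => apr I (free_gen K i)).
  by exists (ev s), (ev t); split; [exact: erefl | exact: erefl | exact: erefl].
exists (linext word_free f).
  by apply: homog_sum => t /fm <-; apply: word_free_homog.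
rewrite (linext_lin _ _ (@linearP _ _ _ _ (apr I))).
by apply: eq_linext => t; rewrite word_evalE.
Qed.

End GradedQuotient.

Arguments gr_comp {K n I} Y r.
Arguments comm_comp {K n} I r.
Arguments lcs_comp {K n} I i r.
Arguments lcs_pr {K n} I i _.
Arguments B_comp {K n} I i r.
Arguments psi {K n} I _.

(* Main.v *)
Require Import Defs.
From mathcomp Require Import all_boot all_order all_algebra.
From mathcomp Require Import boolp classical_sets functions reals complex.
From mathcomp Require Import finmap monalg.

Set Implicit Arguments.
Unset Strict Implicit.
Unset Printing Implicit Defensive.

Import GRing.Theory.
Local Open Scope classical_set_scope.
Local Open Scope ring_scope.

(** Let L_i be the lower central series of A, let A_r be its component of
degree r, and call a Lie element any combination of left-normed brackets
[x_i1, [x_i2, ... x_id]]; those of degree d lie in L_d.  The heart of the matter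
is that, away from characteristic 3, the space L_3 = [A, [A, A]] is already
[A_1 + A_2, [A, A]]: only generators and products of two generators are needed
in the outer slot (lemma [lcs3_small]).

Granting this, every element of [A, A] of degree d >= m - 1 is a Lie element, by
induction on d (lemmas [L2_lie_step] and [L2_lie_ge]).  In degrees m - 1 and m
this is the surjectivity of psi, because brackets of Lie elements are Lie
elements.  In a degree d > m, the vanishing of B_2 puts the element in L_3, so
it is a combination of [x_j, u] and [x_j x_k, u] with u in [A, A] of degree
d - 1, respectively d - 2.  By induction u is a Lie element, which settles the
first kind.  For the second kind, the adjoint action of a left-normed bracket of
length d - 2 is a combination of composites of d - 2 operators [x_i, -], so
[u, x_j x_k] is a combination of brackets [x_i, v] with v in [A, A] of degree
d - 1, and v is a Lie element by induction.  The two lengths 1 and 2 in the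
outer slot are the reason for assuming surjectivity in two consecutive degrees.
Hence [A, A][l] is contained in L_l, and the remaining claims follow because the
L_i decrease and L_{l+1} vanishes in degree l.

For L_3, put Y = [A_1 + A_2, [A, A]] and show [w, [A, A]] <= Y by induction on
the degree of the monomial w.  As [A, A] is spanned by brackets [x_i, e], and a
monomial of degree at least 3 is a product abc with a and b generators, it is
enough to prove: if [t, [A, A]] <= Y whenever t is one of a, b, c, d or a
product of two of them, then [abc, [d, e]] is in Y (lemma [comm_mul3]).  The
only properties of N(u, v) = [u, v] mod Y that matter are biadditivity,
antisymmetry, and the identity N(uv, w) + N(vw, u) + N(wu, v) = 0.  The
assumption says that N(t, -) vanishes on commutators.  It makes
F_u(x, y, z) = N(x, [y, z] u) alternating in x, y, z, and one computes N(abc, [d, e]) = F_{[e, b]}(a, c, d).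
Since N(abc, [d, e]) does not change when a, b, c are rotated, the three terms
F_{[e, d]}(a, b, c), F_{[e, b]}(a, c, d) and F_{[e, c]}(a, d, b) are equal; they
add up to zero by the Jacobi identity, so three times each of them is zero. *)

(** * Cyclic forms on a ring *)

Section CyclicForm.
Variables (A : pzRingType) (M : zmodType) (N : A -> A -> M).
Hypothesis N_add : forall x, zmod_morphism (N x).
Hypothesis N_anti : forall x y, N x y = - N y x.
Hypothesis N_cyc : forall x y z, N (x * y) z + N (y * z) x + N (z * x) y = 0.

Definition tracial (x : A) := forall u v, N x (u * v) = N x (v * u).

Local Notation "[ x , y ]" := (x * y - y * x) : ring_scope.

Lemma form0 x : N x 0 = 0.
Proof. by rewrite -(subrr (0 : A)) N_add subrr. Qed.

Lemma formN x u : N x (- u) = - N x u.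
Proof. by rewrite -[- u]sub0r N_add form0 sub0r. Qed.

Lemma formD x u v : N x (u + v) = N x u + N x v.
Proof. by rewrite -[v in LHS]opprK N_add formN opprK. Qed.

Lemma form_mull x y z : N (x * y) z = N x (y * z) + N y (z * x).
Proof.
apply/eqP; rewrite -subr_eq0 opprD addrA -(N_anti (y * z)) -(N_anti (z * x)).
by rewrite N_cyc.
Qed.

(** Expand N(xy, uv) = N(xy, vu) in both products; since y is tracial,
N(y, uvx) = N(y, xuv). *)
Lemma form_exchange x y u v : tracial y -> tracial (x * y) ->
  N x (y * [u, v]) = N y (x * [v, u]).
Proof.
move=> ty txy; have := txy u v; rewrite !form_mull -!(ty x) => E.
rewrite !mulrBr !N_add; apply/eqP.
by rewrite subr_eq addrAC eq_sym subr_eq eq_sym E addrC.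
Qed.

(** As a function of x, y, z this form alternates when x, y and xy are tracial:
[alt_form_swapr] and [alt_form_swapl] are its two transpositions. *)
Definition alt_form x y z u := N x ([y, z] * u).

Lemma alt_form_add x y z : zmod_morphism (alt_form x y z).
Proof. by move=> u v; rewrite /alt_form mulrBr N_add. Qed.

Lemma alt_form_swapr x y z u : alt_form x y z u = - alt_form x z y u.
Proof. by rewrite /alt_form -[y * z - _]opprB mulNr formN. Qed.

Definition tracial_pair x y :=
  [/\ tracial x, tracial y, tracial (x * y) & tracial (y * x)].

Lemma tracial_pairC x y : tracial_pair x y -> tracial_pair y x.
Proof. by case. Qed.

Lemma alt_form_swapl x y z u : tracial_pair x y ->
  alt_form x y z u = - alt_form y x z u.
Proof.
move=> [tx ty txy _].
(* u is moved inside the commutator, where [form_exchange] applies *)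
have E t s : tracial t -> alt_form t s z u = N t (s * [z, u]).
  by move=> tt; rewrite /alt_form mulrBl mulrBr !N_add -!mulrA (tt z) -mulrA.
by rewrite !E // form_exchange // -[u * z - _]opprB mulrN formN.
Qed.

Lemma form_mul3 a b c q : tracial b -> tracial c ->
  N (a * b * c) q = N a (b * c * q) + N b (a * c * q) + N c (a * b * q).
Proof.
move=> tb tc; rewrite -mulrA form_mull [N (b * c) _]form_mull !mulrA addrA.
congr (_ + _ + _); first by rewrite (tb _ a) !mulrA.
by rewrite -(mulrA q) (tc q).
Qed.

(** By [form_mul3], N(abc, [d, e]) is a sum of three terms, each of which yields
two alternating forms because bracketing with d is a derivation.  Of these six
forms four cancel by antisymmetry, and the two left over share the arguments
a, c, d. *)
Lemma form_mul3_comm a b c d e :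
  tracial_pair a b -> tracial_pair a c -> tracial_pair b c ->
  N (a * b * c) [d, e] = alt_form a c d [e, b].
Proof.
move=> tab tac tbc; case: (tab) (tbc) => ta tb _ _ [_ tc _ _].
rewrite form_mul3 //.
have E x y z : tracial x -> N x (y * z * [d, e]) =
    alt_form x z d (e * y) + alt_form x y d (z * e).
  move=> tx; have -> : N x (y * z * [d, e]) = N x ([y * z, d] * e).
    by rewrite mulrBr mulrBl !N_add (mulrA _ e) (tx _ d) !mulrA.
  rewrite /alt_form (mulrA _ e) -(tx y) -formD !mulrA -mulrDl.
  by congr (N x (_ * e)); rewrite mulrBr mulrBl !mulrA addrA subrK.
rewrite !E //.
have [swab swac swbc] : [/\ forall z u, alt_form b a z u = - alt_form a b z u,
  forall z u, alt_form c a z u = - alt_form a c z u &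
  forall z u, alt_form c b z u = - alt_form b c z u].
  by split=> z u; apply/alt_form_swapl/tracial_pairC.
rewrite swab swac swbc (addrACA _ _ _ (- alt_form a b d _)) subrr addr0.
by rewrite addrA addrK alt_form_add.
Qed.

(** The difference of both sides is N(b, [a, c] q) + N(c, [a, b] q) with
q = [u, v], a sum of two alternating forms that differ by an odd permutation. *)
Lemma form_mul3_rot a b c u v :
  tracial_pair a b -> tracial_pair a c -> tracial_pair b c ->
  N (a * b * c) [u, v] = N (b * c * a) [u, v].
Proof.
move=> tab tac tbc; case: (tab) (tbc) => ta tb _ _ [_ tc _ _].
rewrite !form_mul3 // -addrA addrC; congr (_ + _).
apply/eqP; rewrite -subr_eq0 opprD addrACA -!N_add -!mulrBl.
rewrite -!/(alt_form _ _ _ _) (alt_form_swapr b a) (alt_form_swapl _ _ tbc).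
by rewrite opprK (alt_form_swapr c a) subrr.
Qed.

(** As a is tracial, N(a, [x, y] [e, z]) = N(a, [z, [x, y]] e), and the sum over
the rotations of b, c, d vanishes by the Jacobi identity. *)
Lemma alt_form_jacobi a b c d e : tracial a ->
  alt_form a b c [e, d] + alt_form a c d [e, b] + alt_form a d b [e, c] = 0.
Proof.
move=> ta; have E x y z : alt_form a x y [e, z] = N a ([z, [x, y]] * e).
  rewrite /alt_form; move: [x, y] => w.
  by rewrite mulrBr mulrBl !N_add (mulrA _ e) (ta _ z) !mulrA.
rewrite !E -!formD -!mulrDl [X in X * e](_ : _ = 0) ?mul0r ?form0 //.
rewrite !mulrBl !mulrBr !mulrA !opprB !addrA.
rewrite !subrK (ACl ((1*8)*(2*5)*(3*6)*(4*7)))/=.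
by rewrite !subrr !addNr !addr0.
Qed.

(** The three terms of [alt_form_jacobi] all equal N(abc, [d, e]): each is the
value of [form_mul3_comm] for a suitable placement of the letters, reached by
rotating the first three of them and by transpositions in the alternating
form. *)
Lemma form_mul3_eq0 a b c d e :
  tracial_pair a b -> tracial_pair a c -> tracial_pair a d ->
  tracial_pair b c -> tracial_pair b d -> tracial_pair c d ->
  N (a * b * c) [d, e] *+ 3 = 0.
Proof.
move=> tab tac tad tbc tbd tcd.
have [tba tca tda] :=
  And3 (tracial_pairC tab) (tracial_pairC tac) (tracial_pairC tad).
have [tcb tdb tdc] :=
  And3 (tracial_pairC tbc) (tracial_pairC tbd) (tracial_pairC tcd).
have Eb : N (a * b * c) [d, e] = alt_form a c d [e, b].
  exact: form_mul3_comm.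
have Ec : N (a * b * c) [d, e] = alt_form a d b [e, c].
  rewrite form_mul3_rot // form_mul3_comm // alt_form_swapl //.
  by rewrite alt_form_swapr opprK.
(* both sides are rotated until the letter a stands in the middle of the
   product, hence in the commutator [e, a] of the alternating form *)
have Ed : N (a * b * c) [d, e] = alt_form a b c [e, d].
  rewrite -[RHS](@form_mul3_comm a d b) // (@form_mul3_rot a d b) //.
  rewrite -(@form_mul3_rot c a b) // (@form_mul3_rot d b a) //.
  rewrite !form_mul3_comm //.
  by rewrite alt_form_swapl // alt_form_swapr opprK.
case: (tab) => ta _ _ _.
by rewrite mulrSr mulr2n {1}Ed {1}Eb Ec alt_form_jacobi.
Qed.

End CyclicForm.

(** * Linear spans and commutator identities *)

Local Notation "1" := (@mone _) : monom_scope.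
Local Notation "x * y" := (mmul x y) : monom_scope.

Section Span.
Variables (K : pzRingType) (V : lmodType K).
Implicit Types (S : set V) (W : submodClosed V).

Lemma lspan_ind S (P : V -> Prop) :
  P 0 -> (forall a x y, S x -> P y -> P (a *: x + y)) ->
  forall v, v \in lspan S -> P v.
Proof.
move=> P0 PS v /asboolP[k [c [s [Ss ->]]]].
elim/big_rec: _ => // i x _ Px; exact: PS.
Qed.

Lemma mem_lspan S v : S v -> v \in lspan S.
Proof.
move=> Sv; apply/asboolP; exists 1%N, (fun=> 1), (fun=> v).
by split=> //; rewrite big_ord1 scale1r.
Qed.

Lemma lspan_sub S W v : (forall s, S s -> s \in W) -> v \in lspan S -> v \in W.
Proof.
move=> SW; move: v; apply: lspan_ind => [|a x y Sx yW]; first exact: rpred0.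
by rewrite rpredD // rpredZ // SW.
Qed.

End Span.

Lemma commutator_cyc (B : pzRingType) (u v w : B) :
  (u * v * w - w * (u * v)) + (v * w * u - u * (v * w))
    + (w * u * v - v * (w * u)) = 0.
Proof.
rewrite !mulrA !addrA (ACl ((1*4)*(2*5)*(3*6)))/=.
by rewrite !subrr addNr !addr0.
Qed.

Lemma commutator_deriv (B : pzRingType) (u v w : B) :
  (u * v - v * u) * w - w * (u * v - v * u) =
  u * (v * w - w * v) - (v * w - w * v) * u
    - (v * (u * w - w * u) - (u * w - w * u) * v).
Proof.
rewrite !mulrBl !mulrBr !mulrA !opprB !addrA.
rewrite [RHS](ACl ((1*8*3*6)*((2*5)*(7*4))))/=.
by rewrite addNr subrr !addr0.
Qed.

Lemma malg_linext (K : fieldType) (M : choiceType) (f : {malg K[M]}) :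
  f = linext (fun k => << k >>) f.
Proof.
rewrite {1}[f]monalgE; apply: eq_bigr => w _; apply/malgP => k.
by rewrite mcoeffZ !mcoeffU mulrnAr mulr1.
Qed.

Section Quotient.
Variables (K : fieldType) (n : nat) (I : tsIdeal (free_alg K n)).
Local Notation A := (algquot I).

Lemma commPl a (x y v : A) : comm (a *: x + y) v = a *: comm x v + comm y v.
Proof. exact: comm_linearl. Qed.

Lemma commPr a (x y v : A) : comm v (a *: x + y) = a *: comm v x + comm v y.
Proof. exact: comm_linearr. Qed.

Lemma comm0l (v : A) : comm 0 v = 0.
Proof. exact: lie0l. Qed.

Lemma comm0r (v : A) : comm v 0 = 0.
Proof. exact: lie0r. Qed.

Lemma comm_lspan (W : submodClosed A) (S T : set A) u v :
  (forall s t, S s -> T t -> comm s t \in W) ->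
  u \in lspan S -> v \in lspan T -> comm u v \in W.
Proof.
move=> STW + vT; move: u; apply: lspan_ind => [|a x y Sx yW].
  by rewrite comm0l rpred0.
rewrite commPl; apply: rpredD; last exact: yW.
apply: rpredZ; move: v vT {yW}.
apply: lspan_ind => [|b z t Tz tW]; first by rewrite comm0r rpred0.
rewrite commPr; apply: rpredD; last exact: tW.
by apply: rpredZ; apply: STW.
Qed.

Lemma comm_anti (u v : A) : comm u v = - comm v u.
Proof. by rewrite /comm opprB. Qed.

Lemma comm_cyc (u v w : A) :
  comm (u * v) w + comm (v * w) u + comm (w * u) v = 0.
Proof. exact: commutator_cyc. Qed.

(** * The quotient algebra: words and degrees *)

Definition mon (w : {fmonom 'I_n}) : A := apr I << w >>.
Local Notation x_ i := (mon (fmu i)).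

Lemma monM (v w : {fmonom 'I_n}) : mon (v * w)%M = mon v * mon w.
Proof.
rewrite /mon -aprM; congr (apr I _).
by symmetry; apply: etrans (fgmulUU 1 1 v w) _; rewrite mulr1.
Qed.

Lemma mon1 : mon 1%M = 1.
Proof. exact: rmorph1. Qed.

Definition words : set A := [set s | exists w, s = mon w].

Lemma apr_linext f : apr I f = linext mon f.
Proof.
rewrite {1}[f]malg_linext; exact: linext_lin (@linearP _ _ _ _ (apr I)).
Qed.

Lemma words_full (u : A) : u \in lspan words.
Proof.
elim/apr_ind: u => f; rewrite apr_linext; apply: rpred_sum => w _.
by apply/rpredZ/mem_lspan; exists w.
Qed.

Lemma word_ind (P : {fmonom 'I_n} -> Prop) :
  P 1%M -> (forall i w, P w -> P (fmu i * w)%M) -> forall w, P w.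
Proof.
move=> P1 PM [s]; elim: s => [|i s /(PM i)].
  by rewrite (_ : FMonom _ = 1%M) //; apply: val_inj; rewrite /= fm1.
rewrite (_ : (_ * _)%M = FMonom (i :: s)) //.
by apply: val_inj; rewrite /= fmM fmU.
Qed.

Definition comm_gens : set A := [set s | exists i w, s = comm (x_ i) (mon w)].

(** The identity [vw, z] = [v, wz] + [w, zv] splits off the letters of the left
factor one at a time. *)
Lemma comm_in_gens (u v : A) : comm u v \in lspan comm_gens.
Proof.
apply: (comm_lspan _ (words_full u) (words_full v)) => _ _ [w ->] [z ->].
elim/word_ind: w z => [|i w IH] z.
  rewrite mon1 /comm mul1r mulr1 subrr; exact: rpred0.
have -> : comm (mon (fmu i * w)%M) (mon z) =
    comm (x_ i) (mon (w * z)%M) + comm (mon w) (mon (z * fmu i)%M).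
  rewrite !monM; apply: (form_mull comm_anti comm_cyc).
apply: rpredD; last exact: IH.
apply: mem_lspan; exists i, (w * z)%M; exact: erefl.
Qed.

Lemma comm1l (u : A) : comm 1 u = 0.
Proof. by rewrite /comm mul1r mulr1 subrr. Qed.

Definition grade r : set A := apr I @` homog (@fdeg 'I_n) r.

Lemma grade_mon w : grade (fdeg w) (mon w).
Proof. by exists << w >> => // k; rewrite msuppU1 inE => /eqP->. Qed.

Lemma gradeB r u v : grade r u -> grade r v -> grade r (u - v).
Proof.
move=> [f fr <-] [g gr <-]; exists (f - g); last exact: raddfB.
by move=> k /(fsubsetP (msuppB_le _ _)); rewrite inE => /orP[/fr|/gr].
Qed.

Lemma grade_comm r s u v : grade r u -> grade s v -> grade (r + s) (comm u v).
Proof.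
move=> [f fr <-] [g gs <-]; rewrite -apr_comm.
exists (f * g - g * f); last exact: erefl.
move=> k /(fsubsetP (msuppB_le _ _)); rewrite inE => /orP[].
  exact: homogM.
by rewrite addnC; apply: homogM.
Qed.

Lemma mem_lcs2 v : v \in lcs I 2 -> v \in lspan comm_gens.
Proof. by apply: lspan_sub => _ [u [w [_ _ ->]]]; apply: comm_in_gens. Qed.

Lemma comm_lcs k (u v : A) : v \in lcs I k.+1 -> comm u v \in lcs I k.+2.
Proof. by move=> vL; apply: mem_lspan; exists u, v. Qed.

(** * The third term of the lower central series *)

(** The brackets [p, [x_i, w]] of total degree r in which the word p has length
1 or 2; over all r they span [A_1 + A_2, [A, A]]. *)
Definition small_gens r : set A := [set s | exists p i w,
  [/\ (0 < fdeg p <= 2)%N, s = comm (mon p) (comm (x_ i) (mon w)) &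
      r = (fdeg p + (1 + fdeg w))%N]].

Lemma grade_small r s : small_gens r s -> grade r s.
Proof.
move=> [p [i [w [_ -> ->]]]]; apply: grade_comm; first exact: grade_mon.
by rewrite -[1%N](fdegU i); apply: grade_comm; apply: grade_mon.
Qed.

Hypothesis char3 : (3%:R : K) != 0.

Lemma mulrn3_eq0 (V : lmodType K) (v : V) : v *+ 3 = 0 -> v = 0.
Proof.
move=> v3; rewrite -[v]scale1r -(mulVf char3) -scalerA scaler_nat v3.
exact: scaler0.
Qed.

Lemma commBr (u w z : A) : comm u (w - z) = comm u w - comm u z.
Proof. by rewrite [w - z]addrC -scaleN1r commPr scaleN1r addrC. Qed.

Definition comm_mod (Y : submodClosed A) (u w : A) : lquot Y :=
  lpi Y (comm u w).

Lemma comm_mod_add Y u : zmod_morphism (comm_mod Y u).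
Proof. by move=> w z; rewrite /comm_mod commBr; apply: raddfB. Qed.

Lemma comm_mod_anti Y u w : comm_mod Y u w = - comm_mod Y w u.
Proof. by rewrite /comm_mod comm_anti; apply: raddfN. Qed.

Lemma comm_mod_cyc Y u w z :
  comm_mod Y (u * w) z + comm_mod Y (w * z) u + comm_mod Y (z * u) w = 0.
Proof.
rewrite /comm_mod; apply: etrans (raddf0 (lpi Y)).
rewrite -[in RHS](comm_cyc u w z); symmetry.
by apply: etrans (raddfD _ _ _) _; congr (_ + _); apply: raddfD.
Qed.

Lemma lpi_eq0 (Y : submodClosed A) u : lpi Y u = 0 <-> u \in Y.
Proof. by rewrite -(raddf0 (lpi Y)) lpi_eq subr0. Qed.

Definition absorbed (Y : submodClosed A) (p : A) :=
  forall u v : A, comm p (comm u v) \in Y.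

Definition absorbed_pair (Y : submodClosed A) (p q : A) :=
  [/\ absorbed Y p, absorbed Y q, absorbed Y (p * q) & absorbed Y (q * p)].

Lemma tracial_mod (Y : submodClosed A) p :
  absorbed Y p -> tracial (comm_mod Y) p.
Proof. by move=> pY u v; apply/lpi_eq; rewrite -commBr; apply: pY. Qed.

(** For the form [u, v] mod Y, [form_mul3_eq0] gives three times the wanted
bracket; this is the only place that restricts the characteristic. *)
Lemma comm_mul3 (Y : submodClosed A) (a b c d e : A) :
  absorbed_pair Y a b -> absorbed_pair Y a c -> absorbed_pair Y a d ->
  absorbed_pair Y b c -> absorbed_pair Y b d -> absorbed_pair Y c d ->
  comm (a * b * c) (comm d e) \in Y.
Proof.
move=> ab ac ad bc bd cd.
have P p q : absorbed_pair Y p q -> tracial_pair (comm_mod Y) p q.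
  case=> Tp Tq Tpq Tqp.
  split; [exact: (tracial_mod Tp) | exact: (tracial_mod Tq) |
    exact: (tracial_mod Tpq) | exact: (tracial_mod Tqp)].
apply/lpi_eq0/mulrn3_eq0.
exact: (form_mul3_eq0 (@comm_mod_add Y) (@comm_mod_anti Y) (@comm_mod_cyc Y)
  e (P _ _ ab) (P _ _ ac) (P _ _ ad) (P _ _ bc) (P _ _ bd) (P _ _ cd)).
Qed.

Lemma word_headE (w : {fmonom 'I_n}) :
  (0 < fdeg w)%N -> exists i z, w = (fmu i * z)%M.
Proof. by elim/word_ind: w => [|i w _ _]; [rewrite fdeg1 | exists i, w]. Qed.

(** Induction on the degree of w.  Beyond degree 2, write w = abc with letters a
and b, and let d = x_i be the letter in a spanning element [x_i, e] of [A, A].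
All of a, b, c, d and the products of two of them have degree less than that
of w, so that the induction hypothesis gives what [comm_mul3] asks for. *)
Lemma comm_word_small w u v :
  comm (mon w) (comm u v) \in lspan [set s | exists r, small_gens r s].
Proof.
set S := [set s | _]; have [k] := ubnP (fdeg w).
elim: k w u v => // k IH w u v; rewrite ltnS => wk.
apply: (comm_lspan (S := [set mon w]) _ _ (comm_in_gens u v)); last first.
  exact: mem_lspan.
move=> {u v} _ _ -> [i [z ->]].
case: (leqP (fdeg w) 2) => [w2|w3].
  have [w0|w0] := posnP (fdeg w).
    rewrite (fdeg_eq0I w0) mon1 comm1l; exact: rpred0.
  apply: mem_lspan; exists (fdeg w + (1 + fdeg z))%N, w, i, z; split=> //.
  by rewrite w0.
have [a [w1 Ew]] := word_headE (ltnW (ltnW w3)).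
have [b [c Ew1]] : exists b c, w1 = (fmu b * c)%M.
  by apply: word_headE; move: w3; rewrite Ew fdegM fdegU; case: fdeg.
have c0 : (0 < fdeg c)%N.
  by move: w3; rewrite Ew Ew1 !fdegM !fdegU; case: fdeg.
have ck : (fdeg c).+2 = fdeg w by rewrite Ew Ew1 !fdegM !fdegU.
have T p : (fdeg p < fdeg w)%N -> absorbed (lspan S) (mon p).
  by move=> pw s t; apply: IH; apply: leq_trans pw wk.
have T2 p q : (0 < fdeg p)%N -> (0 < fdeg q)%N ->
    (fdeg p + fdeg q < fdeg w)%N -> absorbed_pair (lspan S) (mon p) (mon q).
  move=> p0 q0 pq; split.
  - by apply: T; apply: leq_trans pq; rewrite ltnS; apply: leq_addr.
  - by apply: T; apply: leq_trans pq; rewrite ltnS; apply: leq_addl.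
  - by rewrite -monM; apply: T; rewrite fdegM.
  - by rewrite -monM; apply: T; rewrite fdegM addnC.
rewrite Ew Ew1 !monM mulrA.
have D1 j : fdeg (fmu j) = 1%N :> nat by exact: fdegU.
by apply: (comm_mul3 (Y := lspan S)); apply: T2; rewrite ?D1 -?ck ?addn1.
Qed.

Lemma lcs3_small v : v \in lcs I 3 ->
  v \in lspan [set s | exists r, small_gens r s].
Proof.
apply: lspan_sub => _ [u [v1 [_ /mem_lcs2 v1L ->]]].
apply: (comm_lspan _ (words_full u) v1L) => _ _ [w ->] [i [z ->]].
exact: comm_word_small.
Qed.

(** * Homogeneous components of spans *)

Section Hcomp.
Variables (M : choiceType) (deg : M -> nat) (d : nat).

Lemma hcompE (f : {malg K[M]}) :
  hcomp deg d f = linext (fun k => if deg k == d then << k >> else 0) f.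
Proof.
rewrite /hcomp /linext big_mkcond; apply: eq_bigr => k _.
case: ifP => _; last by rewrite scaler0.
by apply/malgP => l; rewrite mcoeffZ !mcoeffU mulrnAr mulr1.
Qed.

Lemma hcompP a (f g : {malg K[M]}) :
  hcomp deg d (a *: f + g) = a *: hcomp deg d f + hcomp deg d g.
Proof. by rewrite !hcompE linext_is_linear. Qed.

Lemma hcompB (f g : {malg K[M]}) :
  hcomp deg d (f - g) = hcomp deg d f - hcomp deg d g.
Proof. by rewrite [f - g]addrC -scaleN1r hcompP scaleN1r addrC. Qed.

Lemma hcomp_id (f : {malg K[M]}) : homog deg d f -> hcomp deg d f = f.
Proof.
move=> fd; rewrite hcompE [RHS]malg_linext /linext.
by apply: eq_big_seq => k /fd ->; rewrite eqxx.
Qed.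

Lemma hcomp_eq0 r (f : {malg K[M]}) :
  homog deg r f -> r != d -> hcomp deg d f = 0.
Proof.
move=> fr rd; rewrite /hcomp big_seq_cond big1 // => k /andP[/fr ->].
by rewrite (negbTE rd).
Qed.

End Hcomp.

Hypothesis I_homog : homogeneous_ideal I.

(** As I is homogeneous, a linear combination of homogeneous elements that lies
in degree d equals the part of it that lies in degree d. *)
Lemma lspan_grade (S : nat -> set A) d u :
  (forall r s, S r s -> grade r s) ->
  u \in lspan [set s | exists r, S r s] -> grade d u -> u \in lspan (S d).
Proof.
move=> Sgr uS [f fd fu].
have [g gu gS] : exists2 g, apr I g = u &
    apr I (hcomp (@fdeg 'I_n) d g) \in lspan (S d).
  move: u uS {f fd fu}; apply: lspan_ind => [|a x y [r Sx] [g <- gS]].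
    exists 0; first exact: raddf0.
    have -> : hcomp (@fdeg 'I_n) d (0 : free_alg K n) = 0.
      by rewrite hcompE; exact: raddf0.
    have -> : apr I 0 = 0 by exact: raddf0.
    exact: rpred0.
  have [f fr Ef] := Sgr _ _ Sx; exists (a *: f + g).
    by rewrite -Ef; exact: linearP.
  rewrite hcompP.
  have -> (p q : free_alg K n) : apr I (a *: p + q) = a *: apr I p + apr I q.
    exact: linearP.
  apply: rpredD; last exact: gS.
  apply: rpredZ; have [rd|rd] := eqVneq r d.
    rewrite hcomp_id; last by rewrite -rd.
    by rewrite Ef; apply: mem_lspan; rewrite -rd.
  rewrite (hcomp_eq0 fr rd).
  have -> : apr I 0 = 0 by exact: raddf0.
  exact: rpred0.
suff -> : u = apr I (hcomp (@fdeg 'I_n) d g) by exact: gS.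
rewrite -fu; apply/(@lpi_eq K _ I); rewrite -[f](hcomp_id fd).
have fgI : f - g \in I by apply/(@lpi_eq K _ I); rewrite -/(apr I _) fu -gu.
have E : hcomp (@fdeg 'I_n) d f - hcomp (@fdeg 'I_n) d g =
    hcomp (@fdeg 'I_n) d (f - g) by symmetry; exact: hcompB.
by rewrite E; apply: I_homog.
Qed.

(** * Lie elements *)

(** The brackets [x_i1, [x_i2, ... [x_ik, s]]] with s in S; for S the set of
generators these are the left-normed brackets of degree k + 1. *)
Definition ad_gens k (S : set A) : set A :=
  iter k (fun S => [set s | exists i v, S v /\ s = comm (x_ i) v]) S.

Definition lie_gens : set A := [set s | exists i, s = x_ i].

Lemma comm_commE (u v w : A) :
  comm (comm u v) w = comm u (comm v w) - comm v (comm u w).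
Proof. exact: commutator_deriv. Qed.

Lemma ad_gensS (S : set A) k i v :
  v \in lspan (ad_gens k S) -> comm (x_ i) v \in lspan (ad_gens k.+1 S).
Proof.
apply: (comm_lspan (S := [set x_ i])) => [_ t -> St|]; last exact: mem_lspan.
by apply: mem_lspan; exists i, t.
Qed.

(** Induction on k by the Jacobi identity
[[x, u], v] = [x, [u, v]] - [u, [x, v]].  With S the generators, this says that
Lie elements are closed under brackets; with S a single element a, it unfolds
the adjoint action of a Lie element on a into iterated brackets with
generators. *)
Lemma comm_ad_gens (S : set A) k l u v :
  u \in lspan (ad_gens k lie_gens) -> v \in lspan (ad_gens l S) ->
  comm u v \in lspan (ad_gens (k + l).+1 S).
Proof.
elim: k l u v => [|k IH] l u v uk vl.
  apply: (comm_lspan _ uk vl) => _ t [i ->] St.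
  exact/ad_gensS/mem_lspan.
apply: (comm_lspan _ uk vl) => _ t [i [w [wk ->]]] /mem_lspan tl.
move/mem_lspan: wk => wk; rewrite comm_commE; apply: rpredB.
  exact/ad_gensS/IH.
by rewrite addSnnS; apply: IH => //; apply: ad_gensS.
Qed.

Lemma ad_gens_ind (S : set A) (P : nat -> A -> Prop) :
  (forall s, S s -> P 0%N s) ->
  (forall k i v, P k v -> P k.+1 (comm (x_ i) v)) ->
  forall k s, ad_gens k S s -> P k s.
Proof.
move=> P0 PS; elim=> [|k IH] s; first exact: P0.
by case=> i [v [/IH Pv ->]]; apply: PS.
Qed.

Lemma grade_ad_gens (S : set A) r k s :
  S `<=` grade r -> ad_gens k S s -> grade (k + r) s.
Proof.
move=> Sr; move: k s; apply: ad_gens_ind => // k i v vk.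
by rewrite addSn -add1n -{1}(fdegU i); apply: grade_comm vk; apply: grade_mon.
Qed.

Lemma ad_gens_lcs k s : ad_gens k lie_gens s -> s \in lcs I k.+1.
Proof. by move: k s; apply: ad_gens_ind => // k i v; apply: comm_lcs. Qed.

Lemma ad_gens_lcs2 (S : set A) k s : ad_gens k.+1 S s -> s \in lcs I 2.
Proof. by case=> i [v [_ ->]]; apply: comm_lcs. Qed.

Lemma lcs_decr k v : v \in lcs I k.+2 -> v \in lcs I k.+1.
Proof.
elim: k v => [//|k IH] v; apply: lspan_sub => _ [u [w [_ /IH wL ->]]].
exact: comm_lcs.
Qed.

Lemma lcs_le j k v : (0 < j <= k)%N -> v \in lcs I k -> v \in lcs I j.
Proof.
case: j => // j /= /subnK <-; elim: (k - _)%N => [//|i IH].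
by rewrite addSn addnS => /lcs_decr; rewrite -addnS; apply: IH.
Qed.

(** A bracket with the unit vanishes, so all words occurring in an iterated
bracket may be taken of positive length. *)
Lemma lcs_grade k v : (1 < k)%N -> v \in lcs I k ->
  v \in lspan [set s | exists r, (k <= r)%N /\ grade r s].
Proof.
case: k => [|[|k]] // _; elim: k v => [|k IH] v.
  move/mem_lcs2; apply: lspan_sub => _ [i [w ->]].
  have [w0|w0] := posnP (fdeg w).
    rewrite (fdeg_eq0I w0) mon1 comm_anti comm1l oppr0; exact: rpred0.
  apply: mem_lspan; exists (1 + fdeg w)%N; split=> //.
  by rewrite -[1%N](fdegU i); apply: grade_comm; apply: grade_mon.
apply: lspan_sub => _ [u [w [_ /IH wL ->]]].
apply: (comm_lspan _ (words_full u) wL) => _ t [z ->] [r [kr tr]].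
have [z0|z0] := posnP (fdeg z).
  rewrite (fdeg_eq0I z0) mon1 comm1l; exact: rpred0.
apply: mem_lspan; exists (fdeg z + r)%N; split; last first.
  by apply: grade_comm tr; apply: grade_mon.
by rewrite -[k.+3]add1n; apply: leq_add.
Qed.

Lemma lcs_grade_eq0 k d v : (d < k)%N -> (1 < k)%N ->
  v \in lcs I k -> grade d v -> v = 0.
Proof.
move=> dk k1 /(lcs_grade k1) vL vd.
have vS : v \in lspan [set s | (k <= d)%N /\ grade d s].
  pose S r : set A := [set s | (k <= r)%N /\ grade r s].
  by apply: (lspan_grade (S := S)) vL vd => r s [].
by move: v vS {vL vd}; apply: lspan_ind => // a x y []; rewrite leqNgt dk.
Qed.

Lemma psi_lie d x : fl_comp K d.+1 x -> psi I x \in lspan (ad_gens d lie_gens).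
Proof.
move=> [f fd <-]; rewrite /psi fl_liftE /linext big_seq.
apply: rpred_sum => t /fd td; apply: rpredZ.
have : exists2 e, lie_deg t = e.+1 & word_eval (fun i => apr I (free_gen K i)) t
    \in lspan (ad_gens e lie_gens).
  elim: t {f fd td} => [i|s [j sE sj] t [l tE tl]] /=.
    by exists 0%N => //; apply: mem_lspan; exists i.
  by exists (j + l).+1; [rewrite sE tE addnS | apply: comm_ad_gens].
by rewrite td => -[e [->]].
Qed.

(** * Elements of [A, A] that are Lie elements *)

Definition L2_lie d := forall v,
  v \in lcs I 2 -> grade d v -> v \in lspan (ad_gens d.-1 lie_gens).

(** By [lcs3_small], v is a combination of brackets [p, u] with p of length 1 or
2 and u in [A, A].  If p has length 2, then u is a Lie element of degree d, and
[comm_ad_gens] turns [u, p] into brackets [x_k, t] where t is p under d - 1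
brackets with generators; as d > 1, such a t lies in [A, A]. *)
Lemma L2_lie_step d : (1 < d)%N -> L2_lie d -> L2_lie d.+1 ->
  forall v, v \in lcs I 3 -> grade d.+2 v ->
  v \in lspan (ad_gens d.+1 lie_gens).
Proof.
case: d => [|[|d]] // _ Hd Hd1 v /lcs3_small v3 vd.
have := lspan_grade grade_small v3 vd.
apply: lspan_sub => _ [p [i [w [/andP[p0 p2] -> dE]]]].
set u := comm (x_ i) _.
have u2 : u \in lcs I 2 by apply: comm_lcs.
have ugr : grade (1 + fdeg w) u.
  by rewrite -[1%N](fdegU i); apply: grade_comm; apply: grade_mon.
have [j [z pE]] := word_headE p0.
have [p1|p1] := leqP (fdeg p) 1.
  have z1 : z = 1%M.
    by apply: fdeg_eq0I; move: p1; rewrite pE fdegM fdegU ltnS leqn0 => /eqP.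
  have -> : mon p = x_ j by rewrite pE z1 monM mon1 mulr1.
  apply/ad_gensS/Hd1 => //; move: dE ugr; rewrite pE z1 fdegM fdegU fdeg1.
  by rewrite addn0 [RHS]add1n => -[->].
have {p1 p2} p2 : fdeg p = 2%N by apply/eqP; rewrite eqn_leq p2.
rewrite comm_anti -scaleN1r; apply: rpredZ.
have uL : u \in lspan (ad_gens d.+1 lie_gens).
  by apply: Hd => //; move: dE ugr; rewrite p2 => -[->].
have pP : mon p \in lspan (ad_gens 0 [set mon p]) by apply: mem_lspan.
apply: lspan_sub (comm_ad_gens uL pP) => s; rewrite addn0 => -[k [t [tad ->]]].
have {}tad : ad_gens d.+1 [set mon p] t by exact: tad.
apply/ad_gensS/Hd1; first exact: ad_gens_lcs2 tad.
have := grade_ad_gens (r := 2%N) _ tad; rewrite addn2; apply => _ ->.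
by rewrite -p2; apply: grade_mon.
Qed.

Lemma L2_lie_ge (q m : nat) : (1 < q)%N ->
  (forall d v, (q <= d)%N -> v \in lcs I 2 -> grade d v -> v \in lcs I 3) ->
  (q < m)%N -> L2_lie m.-1 -> L2_lie m ->
  forall d, (m.-1 <= d)%N -> L2_lie d.
Proof.
case: m => // m q1 L23 qm Hm Hm1 /= d /subnK <-.
suff [] : L2_lie (d - m + m) /\ L2_lie (d - m + m).+1 by [].
elim: (d - m)%N => [//|k [H0 H1]]; split=> // v v2 vd.
have qk : (q <= k + m)%N by apply: leq_trans (leq_addl _ _).
apply: (L2_lie_step _ H0 H1) => //; first exact: leq_trans qk.
apply: (L23 (k + m).+2) => //; rewrite -addn2.
exact: leq_trans (leq_addr _ _).
Qed.

Lemma L2_lie_surj d : (1 < d)%N ->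
  set_surj (fl_comp K d) (comm_comp I d) (psi I) -> L2_lie d.
Proof.
case: d => // d _ psi_surj v v2 vd.
have [x xd <-] := psi_surj v (conj v2 vd).
exact: psi_lie.
Qed.

Lemma B_comp_eq0 s d : B_comp I s d = [set 0] <->
  (forall v, v \in lcs I s -> grade d v -> v \in lcs I s.+1).
Proof.
split=> [B0 v vs vd|H].
  apply/lpi_eq0; have : B_comp I s d (lcs_pr I s v) by exists v.
  by rewrite B0.
apply/seteqP; split=> [_ [v [vs vd] <-]|_ ->].
  by apply/lpi_eq0; apply: H.
exists 0; last exact: raddf0.
split; first exact: rpred0.
exists 0; last exact: raddf0.
by move=> k; rewrite msupp0 inE.
Qed.

Theorem lcs_stable (q m : nat) : (1 < q)%N -> (q < m)%N ->
  (forall d, (q <= d)%N -> B_comp I 2 d = [set 0]) ->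
  set_surj (fl_comp K m) (comm_comp I m) (psi I) ->
  set_surj (fl_comp K m.-1) (comm_comp I m.-1) (psi I) ->
  forall l, (m.-1 <= l)%N ->
  [/\ comm_comp I l = lcs_comp I l l,
      set_bij (lcs_comp I l l) (B_comp I l l) (lcs_pr I l) &
      forall s, (2 <= s <= l.-1)%N -> B_comp I s l = [set 0]].
Proof.
move=> q1 qm B2 surj surj1 l ml.
have q_le : (q <= m.-1)%N by case: (m) qm.
have l1 : (1 < l)%N by apply: leq_trans q1 (leq_trans q_le ml).
have lie_l : forall v, v \in lcs I 2 -> grade l v -> v \in lcs I l.
  have L l' : L2_lie l' -> (0 < l')%N -> forall v, v \in lcs I 2 ->
      grade l' v -> v \in lcs I l'.
    move=> Ll l0 v v2 vl; rewrite -(prednK l0).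
    by apply: lspan_sub (Ll v v2 vl) => s; apply: ad_gens_lcs.
  apply: L; last exact: ltnW.
  apply: (L2_lie_ge q1 _ qm) ml => [d v qd||].
  - by move: v; apply/B_comp_eq0/B2.
  - by apply: L2_lie_surj surj1; apply: leq_trans q_le.
  - by apply: L2_lie_surj surj; apply: leq_trans (ltnW qm).
split.
- apply/seteqP; split=> v [vl vd]; split=> //; first exact: lie_l.
  by apply: (@lcs_le 2%N l v _ vl); rewrite l1.
- split; first by move=> v vl; exists v.
    move=> u v /set_mem[ul ud] /set_mem[vl vd] /lpi_eq uv.
    apply/eqP; rewrite -subr_eq0; apply/eqP.
    by apply: lcs_grade_eq0 uv (gradeB ud vd); rewrite // ltnW.
  by [].
- move=> s /andP[s2 sl]; apply/B_comp_eq0 => v vs vl.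
  apply: (@lcs_le s.+1 l); first by rewrite -(prednK (ltnW l1)).
  by apply: lie_l => //; apply: lcs_le vs; rewrite s2.
Qed.

End Quotient.

Theorem proposition11p4 (R : realType) (n : nat)
    (I : tsIdeal (free_alg (complex R) n)) (I_homog : homogeneous_ideal I)
    (q : nat) (q_ge3 : (3 <= q)%N)
    (B2_eq0 : forall d : nat, (q <= d)%N -> B_comp I 2 d = [set 0])
    (m : nat) (m_gtq : (q.+1 <= m)%N)
    (psi_surj : set_surj (fl_comp (complex R) m) (comm_comp I m) (psi I))
    (psi_surj1 :
      set_surj (fl_comp (complex R) m.-1) (comm_comp I m.-1) (psi I))
    (l : nat) (l_ge : (m.-1 <= l)%N) :
  [/\ comm_comp I l = lcs_comp I l l,
      set_bij (lcs_comp I l l) (B_comp I l l) (lcs_pr I l) &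
      forall s : nat, (2 <= s <= l.-1)%N -> B_comp I s l = [set 0]].
Proof.
apply: (lcs_stable _ I_homog (ltnW q_ge3) m_gtq B2_eq0 psi_surj psi_surj1 l_ge).
by rewrite Num.Theory.pnatr_eq0.
Qed.
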